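(* Let $X$ be a group. Then there is exactly one connected Alexandroff topology on $X$ that turns $X$ into a topological group, and it is the trivial (indiscrete) topology.
   Context: An Alexandroff topology is a topology in which arbitrary intersections of open sets are open. A topological group is a group endowed with a topology for which both multiplication and inversion are continuous; no separation axioms are assumed. *)

(* Defs.v *)
From HB Require Import structures.
From mathcomp Require Import all_boot.
From mathcomp Require Import all_classical.
From mathcomp Require Import topology.

Set Implicit Arguments.
Unset Strict Implicit.
Unset Printing Implicit Defensive.

Local Open Scope classical_set_scope.

HB.structure Definition PreTopologicalGroup :=
  {G of Topological G & Group G}.

Definition topological_group (G : PreTopologicalGroup.type) : Prop :=
  continuous (fun p : G * G => (p.1 * p.2)%g) /\
  continuous (fun x : G => x^-1%g).

Definition alexandroff (T : topologicalType) : Prop :=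
  forall F : set_system T, F `<=` open -> open (\bigcap_(A in F) A).

(* Topologies on a fixed type as first-class values, so that one can quantify
   over them. The empty set is open as the union of the empty family. *)
Record topology_on (X : Type) := TopologyOn {
  opens : set_system X ;
  opens_setT : opens setT ;
  opens_setI : setI_closed opens ;
  opens_bigcup : forall F : set_system X,
    F `<=` opens -> opens (\bigcup_(A in F) A)
}.

Lemma topology_on_ext (X : Type) (t u : topology_on X) :
  opens t = opens u -> t = u.
Proof.
case: t u => [O OT OI OU] [P PT PI PU] /= OP; subst P.
by congr TopologyOn; exact: Prop_irrelevance.
Qed.

(* The type X carrying the topology t. *)
Definition space (X : choiceType) (t : topology_on X) : Type := X.

Section SpaceTopology.
Context (X : choiceType) (t : topology_on X).

Lemma opens_bigcup_fam (I : Type) (f : I -> set X) :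
  (forall i, opens t (f i)) -> opens t (\bigcup_i f i).
Proof.
move=> tf; have -> : \bigcup_i f i = \bigcup_(A in range f) A.
  by rewrite bigcup_image.
by apply: opens_bigcup => _ [i _ <-].
Qed.

HB.instance Definition _ := Choice.on (space t).
HB.instance Definition _ := isOpenTopological.Build (space t)
  (@opens_setT X t) (@opens_setI X t) opens_bigcup_fam.

Lemma open_spaceE : (open : set_system (space t)) = opens t.
Proof. by []. Qed.

End SpaceTopology.

HB.instance Definition _ (X : groupType) (t : topology_on X) :=
  Group.on (space t).

Section Indiscrete.
Context (X : Type).
Let O : set_system X := [set set0; setT].

Lemma indiscrete_setT : O setT. Proof. by right. Qed.

Lemma indiscrete_setI : setI_closed O.
Proof.
by move=> A B [->|->] [->|->]; rewrite ?set0I ?setI0 ?setTI;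
  [left|left|left|right].
Qed.

Lemma indiscrete_bigcup (F : set_system X) :
  F `<=` O -> O (\bigcup_(A in F) A).
Proof.
move=> FO; have [FT|FT] := pselect (F setT); [right|left].
  by apply/seteqP; split=> // x _; exists setT.
apply/seteqP; split=> // x [A FA Ax].
by case: (FO A FA) => E; rewrite E // in FA Ax.
Qed.

Definition indiscrete : topology_on X :=
  TopologyOn indiscrete_setT indiscrete_setI indiscrete_bigcup.

End Indiscrete.

(* Main.v *)
Require Import Defs.
From HB Require Import structures.
From mathcomp Require Import all_boot.
From mathcomp Require Import all_classical.
From mathcomp Require Import topology.

Local Open Scope classical_set_scope.

(** In an Alexandroff space every point [x] has a smallest open neighborhood
    [N x]. Translations and inversion are homeomorphisms, so [y \in N x] gives
    [y^-1 \in N x^-1] and then, multiplying by [y] on the left and by [x] on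
    the right, [x \in N y]. Hence every open set, being a union of classes of
    this equivalence relation, is also closed, and connectedness leaves only
    the empty set and the whole group. *)

(** As a relation, [nbhd_core T x y] is the specialization preorder: [x] lies in the closure of the
    point [y]. *)
Definition nbhd_core (T : topologicalType) (x : T) : set T :=
  \bigcap_(A in [set A : set T | open A /\ A x]) A.

Lemma open_nbhd_core (T : topologicalType) (x : T) :
  alexandroff T -> open (nbhd_core T x).
Proof. by apply => A []. Qed.

Lemma nbhd_core_self (T : topologicalType) (x : T) : nbhd_core T x x.
Proof. by move=> A []. Qed.

Lemma nbhd_core_continuous (S T : topologicalType) (f : S -> T) (x y : S) :
  continuous f -> nbhd_core S x y -> nbhd_core T (f x) (f y).
Proof.
move=> /continuousP fC xy A [oA Afx]; apply: (xy (f @^-1` A)).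
by split=> //; exact: fC.
Qed.

Lemma nbhd_core_sym (G : PreTopologicalGroup.type) (x y : G) :
  topological_group G -> nbhd_core G x y -> nbhd_core G y x.
Proof.
move=> [mulC invC] /(nbhd_core_continuous G G _ x y invC) xyV.
(* This map sends [x^-1] to [y] and [y^-1] to [x], so it carries [xyV] to the goal. *)
have fC : continuous (fun z : G => (y * z * x)%g).
  have lC : continuous (fun z : G => (y * z)%g).
    move=> z; apply: (continuous_comp (f := fun z : G => (y, z)) _ (mulC _)).
    exact: (cvg_pair (cvg_cst y) cvg_id).
  move=> z.
  apply: (continuous_comp (f := fun z : G => ((y * z)%g, x)) _ (mulC _)).
  exact: (cvg_pair (lC z) (cvg_cst x)).
have := nbhd_core_continuous _ _ _ _ _ fC xyV.
by rewrite mulgVK mulgV mul1g.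
Qed.

Lemma alexandroff_group_open_closed (G : PreTopologicalGroup.type)
    (U : set G) :
  alexandroff G -> topological_group G -> open U -> closed U.
Proof.
move=> alexG tgG oU; rewrite -openC.
have -> : ~` U = \bigcup_(z in ~` U) nbhd_core G z.
  apply/seteqP; split=> [z nUz|y [z nUz zy] Uy].
    by exists z => //; exact: nbhd_core_self.
  (* By symmetry [z] lies in the core of [y], which is contained in the open set [U] around [y]. *)
  by apply: nUz; apply: (nbhd_core_sym _ _ _ tgG zy).
by apply: bigcup_open => z _; exact: open_nbhd_core.
Qed.

Lemma connected_clopen (T : topologicalType) (U : set T) :
  connected [set: T] -> open U -> closed U -> U = set0 \/ U = setT.
Proof.
move=> connT oU cU; have [->|/set0P U0] := eqVneq U set0; first by left.
(* [U] is its own trace on the whole space, both as an open and as a closed set. *)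
by right; apply: connT => //; exists U; rewrite ?setTI.
Qed.

Lemma connected_alexandroff_group_indiscrete (X : groupType)
    (t : topology_on X) :
  connected [set: space t] -> alexandroff (space t) ->
  topological_group (space t) -> t = indiscrete X.
Proof.
move=> connt alext tgt; apply: topology_on_ext.
apply/seteqP; split=> [U tU|U [->|->]]; last exact: opens_setT.
- apply: (connected_clopen (space t)) => //.
  exact: (alexandroff_group_open_closed (space t)).
- exact: (@open0 (space t)).
Qed.

(** Applied below to multiplication and inversion, whose sources carry different topologies. *)
Lemma continuous_indiscrete (X : choiceType) (S : topologicalType)
    (f : S -> space (indiscrete X)) : continuous f.
Proof.
apply/continuousP => A [->|->]; rewrite ?preimage_set0 ?preimage_setT.
- exact: open0.
- exact: openT.
Qed.

Lemma connected_indiscrete (X : choiceType) :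
  connected [set: space (indiscrete X)].
Proof.
(* The nonempty [B] is the trace of an open [C]; taking [C] empty would contradict [Bx]. *)
move=> B [x Bx] [C [->|->]]; last by rewrite setTI.
by rewrite setI0 => B0; rewrite B0 in Bx.
Qed.

Lemma alexandroff_indiscrete (X : choiceType) :
  alexandroff (space (indiscrete X)).
Proof.
(* If [set0] is in [F] the intersection is empty; otherwise [setT] is the only possible member, and
   the intersection is everything even when [F] is empty. *)
move=> F Fo; have [F0|F0] := pselect (F set0); [left|right].
  by apply/seteqP; split=> // x /(_ _ F0).
apply/seteqP; split=> // x _ A FA.
by case: (Fo A FA) => E; rewrite E // in FA *.
Qed.

Lemma topological_group_indiscrete (X : groupType) :
  topological_group (space (indiscrete X)).
Proof. by split; exact: continuous_indiscrete. Qed.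

Theorem corollary3p7 (X : groupType) :
  (exists! t : topology_on X,
     [/\ connected [set: space t], alexandroff (space t)
       & topological_group (space t)]) /\
  (forall t : topology_on X,
     [/\ connected [set: space t], alexandroff (space t)
       & topological_group (space t)] -> t = indiscrete X).
Proof.
have uniq_t t : [/\ connected [set: space t], alexandroff (space t)
    & topological_group (space t)] -> t = indiscrete X.
  by case; exact: connected_alexandroff_group_indiscrete.
split=> //; exists (indiscrete X); split=> [|t /uniq_t //].
split.
- exact: connected_indiscrete.
- exact: alexandroff_indiscrete.
- exact: topological_group_indiscrete.
Qed.
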